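(* (a) For all types $\tau,\sigma\Vdash n$, the coefficient of $m^\otimes_\tau$ in the $m^{\otimes}$-expansion of $E^+_\sigma$ is \[ \mathcal{M}(E^+, m^\otimes)_{\tau, \sigma} = |\mathrm{ETBT}(\tau, \sigma)|. \] (b) For all types $\tau,\sigma\Vdash n$, the coefficient of $m^\otimes_\tau$ in the $m^{\otimes}$-expansion of $E_\sigma$ is \[ \mathcal{M}(E, m^\otimes)_{\tau, \sigma} = \sum_{T\in \mathrm{ETBT}(\tau,\sigma)} \operatorname{sgn}(T). \]
   Context: An integer partition is a finite (possibly empty) weakly decreasing sequence of positive integers; $\ell(\lambda)$ is its number of parts and $m_k(\lambda)$ the number of parts equal to $k$. A block is an ordered pair of positive integers written $d^m$ (degree $d$, multiplicity $m$). Blocks are ordered by $a^b\ge d^e$ iff $a>d$, or $a=d$ and $b\ge e$. A type is a finite (possibly empty) weakly decreasing sequence of blocks $\tau=(d_1^{r_1},\dots,d_s^{r_s})$; its weight is $|\tau|=\sum_id_ir_i$, and $\tau\Vdash n$ means $|\tau|=n$. For $k\ge1$, $\tau|_k$ denotes the integer partition formed by the multiplicities of the blocks of $\tau$ of degree $k$. The tensor diagram of $\tau$ is the sequence of partition diagrams $\mathrm{dg}(\tau|_1)\otimes\mathrm{dg}(\tau|_2)\otimes\cdots$; the $k$th component has left-justified rows of boxes of lengths the parts of $\tau|_k$. Variables: $x_{k,j}$ for $k,j\ge 1$, with $\deg x_{k,j}=k$; $\mathbf{x}_{k*}=(x_{k,1},x_{k,2},\dots)$. The graded algebra $\mathsf{P\Lambda}=\bigoplus_n\mathsf{P\Lambda}^n$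 of polysymmetric functions consists of the formal series over $\mathbb{Q}$ of bounded degree in all the $x_{k,j}$ that, for each fixed $k$, are unchanged by any permutation of the variables $\mathbf{x}_{k*}$. Define $m^{\otimes}_\tau=\prod_{k\ge1}m_{\tau|_k}(\mathbf{x}_{k*})$, where $m_\lambda$ is the monomial symmetric function; $\{m^\otimes_\tau:\tau\Vdash n\}$ is a basis of $\mathsf{P\Lambda}^n$. $E^+_d$ is the sum of all square-free monomials (no variable repeated) of degree $d$ in the variables $x_{k,j}$ (with $\deg x_{k,j}=k$); $E_d$ is the sum of the same monomials, each multiplied by $(-1)^q$ where $q$ is the number of variables in the monomial. $E^+_{d^r}$ and $E_{d^r}$ are obtained from $E^+_d$ and $E_d$ by replacing every variable $x_{k,j}$ by $x_{k,j}^r$; for $\sigma=(d_1^{r_1},\dots,d_s^{r_s})$, $E^+_\sigma=\prod_{i=1}^sE^+_{d_i^{r_i}}$ and $E_\sigma=\prod_{i=1}^sE_{d_i^{r_i}}$. For $F\in\{E^+,E\}$ the transition matrix is defined by $F_\sigma=\sum_{\tau\Vdash n}\mathcal{M}(F,m^\otimes)_{\tau,\sigma}m^\otimes_\tau$ for $\sigma\Vdash n$. For $\sigma=(d_1^{r_1},\dots,d_s^{r_s})$, $\mathrm{ETBT}(\tau,\sigma)$ is the set of $E$-tensor brick tabloids of shape $\tau$ and content $\sigma$: coverings $T$ of the tensor diagram of $\tau$ by labeled horizontal bricks (height $1$, each lying within a single row of a component, every box covered by exactly one brick) built as follows. Choose partitions $\lambda^{(i)}$ of $d_i$ for $i=1,\dots,s$.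 For each $k\ge1$, the $k$th component $\mathrm{dg}(\tau|_k)$ is covered using exactly $m_k(\lambda^{(i)})$ bricks labeled $i$, each of length $r_i$, for each $i=1,\dots,s$. The brick labels must strictly increase from left to right in each row. Bricks with the same label are indistinguishable. The sign is $\operatorname{sgn}(T)=\prod_{i=1}^s(-1)^{\ell(\lambda^{(i)})}$ (so the exponent of $-1$ is the total number of bricks in $T$). *)

(* Defs.v *)
From mathcomp Require Export all_boot all_algebra.
From mathcomp Require Export finmap.
From mathcomp Require Export mathcomp_extra boolp classical_sets fsbigop.
From mathcomp.multinomials Require Export monalg.

Set Implicit Arguments.
Unset Strict Implicit.
Unset Printing Implicit Defensive.

Import GRing.Theory.

Local Open Scope ring_scope.

Definition is_partition (d : nat) (lam : seq nat) : bool :=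
  [&& sorted geq lam, 0%N \notin lam & sumn lam == d].

(* The block [d^m] is the pair [(d, m)]. *)
Definition block : Type := (nat * nat)%type.

Definition block_ge (b c : block) : bool :=
  (c.1 < b.1)%N || ((b.1 == c.1) && (c.2 <= b.2)%N).

Definition is_type (tau : seq block) : bool :=
  all (fun b => (0 < b.1)%N && (0 < b.2)%N) tau && sorted block_ge tau.

Definition weight (tau : seq block) : nat := (\sum_(b <- tau) b.1 * b.2)%N.

Definition type_of (n : nat) (tau : seq block) : bool :=
  is_type tau && (weight tau == n).

(* When [tau] is a type this is weakly decreasing, by the order on blocks. *)
Definition restr (tau : seq block) (k : nat) : seq nat :=
  [seq b.2 | b <- tau & b.1 == k].

(* The pair [(k, j)], with [k, j >= 0], stands for the variable
   x_{k+1,j+1}, of degree k+1. *)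
Definition var : Type := (nat * nat)%type.
Definition vdeg (v : var) : nat := v.1.+1.

(* A formal series over [rat] in the variables x_{k,j} is the family of its
   coefficients. *)
Definition series : Type := {cmonom var} -> rat.

Definition mondeg (m : {cmonom var}) : nat :=
  (\sum_(v <- finsupp m) vdeg v * m v)%N.

Definition sone : series := fun m => (m == mone)%:R.

(* Cauchy product; a monomial has finitely many factorisations. *)
Definition smul (f g : series) : series := fun m =>
  \sum_(p \in [set p : {cmonom var} * {cmonom var} |
                 mmul p.1 p.2 = m]%classic) f p.1 * g p.2.

(* Substitution of x_{k,j}^r for x_{k,j}: the coefficient of [m] is that of
   the (for r > 0, at most one) monomial whose r-th power is [m]. *)
Definition spow (r : nat) (f : series) : series := fun m =>
  \sum_(p \in [set p : {cmonom var} | expcmn p r = m]%classic) f p.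

(* m_lam(x_{k*}): the sum of the distinct monomials in the x_{k,j}, j >= 1,
   whose nonzero exponents are the parts of [lam] in some order. *)
Definition msym (lam : seq nat) (k : nat) : series := fun m =>
  (all (fun v => vdeg v == k) (finsupp m)
   && perm_eq [seq m v | v <- finsupp m] lam)%:R.

(* The product over k >= 1 stops at the weight of [tau]: the blocks of a type
   have degree at most its weight, and the remaining factors are m_[::] = 1. *)
Definition mtensor (tau : seq block) : series :=
  \big[smul/sone]_(1 <= k < (weight tau).+1) msym (restr tau k) k.

Definition squarefree (m : {cmonom var}) : bool :=
  all (fun v => m v == 1%N) (finsupp m).

Definition Eplus_deg (d : nat) : series := fun m =>
  (squarefree m && (mondeg m == d))%:R.

Definition E_deg (d : nat) : series := fun m =>
  (-1) ^+ size (finsupp m) * (squarefree m && (mondeg m == d))%:R.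

Definition Eplus (sigma : seq block) : series :=
  \big[smul/sone]_(b <- sigma) spow b.2 (Eplus_deg b.1).

Definition E (sigma : seq block) : series :=
  \big[smul/sone]_(b <- sigma) spow b.2 (E_deg b.1).

Definition is_expansion (n : nat) (f : series) (c : seq block -> rat) : Prop :=
  forall m, f m =
    \sum_(tau \in [set tau : seq block | type_of n tau]%classic)
      c tau * mtensor tau m.

(* The coefficient of m^(x)_tau in the expansion of [f], for [f] homogeneous
   of degree [n]; the values at the types of weight [n] are unique because the
   m^(x)_tau are linearly independent. *)
Definition mtensor_coef (n : nat) (f : series) (tau : seq block) : rat :=
  xget (fun=> 0) [set c | is_expansion n f c]%classic tau.

Definition transition (n : nat) (F : seq block -> series)
    (tau sigma : seq block) : rat :=
  mtensor_coef n (F sigma) tau.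

Definition row_length (tau : seq block) (k i : nat) : nat :=
  nth 0%N (restr tau k) i.

(* Cells [(k, i, c)]: component, row and column, with rows and columns
   numbered from 0. The bound on the three coordinates excludes no box of the
   tensor diagram of a type. *)
Definition cell (tau : seq block) : finType :=
  ('I_(weight tau).+1 * 'I_(weight tau).+1 * 'I_(weight tau).+1)%type.

Definition cell_comp tau (x : cell tau) : nat := x.1.1.
Definition cell_row tau (x : cell tau) : nat := x.1.2.
Definition cell_col tau (x : cell tau) : nat := x.2.

Definition diagram (tau : seq block) : {set cell tau} :=
  [set x : cell tau | (0 < cell_comp x)%N
     && (cell_col x < row_length tau (cell_comp x) (cell_row x))%N]%SET.

(* A positioned brick: its leftmost box and its label; the label [i], numbered
   from 0, determines the length r_i. *)
Definition brick (tau sigma : seq block) : finType :=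
  (cell tau * 'I_(size sigma))%type.

Section Bricks.
Variables tau sigma : seq block.
Implicit Types (b : brick tau sigma) (T : {set brick tau sigma}).

Definition block_at (i : 'I_(size sigma)) : block := nth (0%N, 0%N) sigma i.

Definition brick_length b : nat := (block_at b.2).2.

Definition fits b : bool :=
  (b.1 \in diagram tau) &&
  (cell_col b.1 + brick_length b
     <= row_length tau (cell_comp b.1) (cell_row b.1))%N.

Definition same_row (x y : cell tau) : bool :=
  (cell_comp x == cell_comp y) && (cell_row x == cell_row y).

Definition covers b (x : cell tau) : bool :=
  same_row b.1 x &&
  (cell_col b.1 <= cell_col x < cell_col b.1 + brick_length b)%N.

Definition is_covering T : bool :=
  [forall b in T, fits b] &&
  [forall x in diagram tau, #|[set b in T | covers b x]%SET| == 1%N].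

Definition labels_increase T : bool :=
  [forall b in T, forall c in T,
     same_row b.1 c.1 && (cell_col b.1 < cell_col c.1)%N ==> (b.2 < c.2)%N].

Definition has_content (lam : {ffun 'I_(size sigma) -> seq nat}) T : Prop :=
  forall i, is_partition (block_at i).1 (lam i) /\
    forall k, (0 < k)%N ->
      #|[set b in T | (cell_comp b.1 == k) && (b.2 == i)]%SET|
        = count_mem k (lam i).

Definition ETBT : {set {set brick tau sigma}} :=
  [set T | [&& is_covering T, labels_increase T
             & `[< exists lam, has_content lam T >]]]%SET.

(* The partitions chosen to build [T]: [T] determines their multiplicities,
   hence the partitions themselves. *)
Definition content T : {ffun 'I_(size sigma) -> seq nat} :=
  xget [ffun=> [::]] [set lam | has_content lam T]%classic.

Definition sgn T : rat :=
  \prod_(i < size sigma) (-1) ^+ size (content T i).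

End Bricks.

(* Main.v *)
Require Import Defs.

Set Implicit Arguments.
Unset Strict Implicit.
Unset Printing Implicit Defensive.

Import GRing.Theory Num.Theory.

(** A monomial [m] has exactly one type [mtype m], the list of its blocks
    (degree of the variable, exponent), and the tensor monomial function of a
    type [tau] is the sum of the monomials of type [tau] ([mtensorE]). So a
    series is a combination of tensor monomial functions of weight [n] when
    its coefficient at [m] is a function of [mtype m] that vanishes unless
    [m] has degree [n] ([is_expansionP]). As every type is the type of some
    monomial, the coefficients of the expansion are then determined
    ([mtensor_coefE]). It remains to find the coefficient of [m] in
    E_sigma and to see that it is the count of tabloids of shape [mtype m].

    Both signs are treated at once: [E_wt e] gives each variable of a
    square-free monomial the weight [e], so that [e = 1] yields E^+ and
    [e = -1] yields E. Expanding the product, a contribution to the coefficient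
    of [m] is a choice, for each block d_i^(r_i) of sigma, of a square-free
    monomial of degree d_i, that is, of a set B_i of variables of [m] whose
    degrees add up to d_i, such that the r_i with x in B_i add up to the
    exponent of x in [m]. Such a family is called an incidence family
    ([E_wt_monom_of]); it weighs e to the power of the sum of the |B_i|.

    The variables of [m] correspond to the rows of the tensor diagram of
    [mtype m]: the component is the degree and the length of the row is the
    exponent ([slot]). A tabloid determines the incidence family where B_i is
    the set of the rows that contain a brick labelled i. Conversely, as labels
    increase along a row, a row is known from the set of its labels: its bricks
    are laid end to end by increasing label, so a brick labelled i starts at the
    sum of the lengths of the bricks with smaller labels ([col_offset]). The
    rows are exactly covered when the lengths add up, and the partition
    chosen for the label i must be the sorted list of the components of the
    rows in B_i, which is a partition of d_i precisely when these degrees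
    add up to d_i ([has_contentP]). This gives a bijection that preserves
    the number of bricks ([sum_ETBT]). *)

Local Open Scope ring_scope.

(** * Powers of monomials and the substitution of powers *)

Lemma expcmnE (m : {cmonom var}) r v : expcmn m r v = (r * m v)%N.
Proof.
rewrite /expcmn; case: r => [|r]; first by rewrite /= onecmE.
elim: r => [|r IH]; first by rewrite /= mul1n.
change (mulcm m (iterop r.+1 (@mulcm _) m (onecm _)) v = (r.+2 * m v)%N).
by rewrite mulcmE IH mulSn.
Qed.

Lemma expcmn_inj r :
  (0 < r)%N -> injective (fun m : {cmonom var} => expcmn m r).
Proof.
move=> r0 p q /eqP/cmP pq; apply/eqP/cmP => v.
by move: (pq v); rewrite !expcmnE => /eqP; rewrite eqn_pmul2l// => /eqP.
Qed.

Lemma spow_expcmn r f (q : {cmonom var}) : (0 < r)%N ->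
  spow r f (expcmn q r) = f q.
Proof.
move=> r0; rewrite /spow.
rewrite (_ : [set _ | _]%classic = [set q]%classic) ?fsbig_set1//.
by apply/seteqP; split=> p /=; [exact: expcmn_inj | move=> ->].
Qed.

Lemma spow_neq0 r f (p : {cmonom var}) :
  spow r f p != 0 -> exists q, p = expcmn q r /\ f q != 0.
Proof.
apply: contra_neqP => np; apply: fsbig1 => q /= qp.
by apply/eqP/negPn/negP => fq; apply: np; exists q.
Qed.

(** * Monomials in a finite family of variables *)

Section MonomOf.
Variables (I : finType) (v : I -> var).
Hypothesis v_inj : injective v.

(** The sum over the fibre of [w] reads off the exponent without choosing an
    inverse of [v]. *)
Definition monom_of (mu : I -> nat) : {cmonom var} :=
  [cmonom (\sum_(x | v x == w) mu x)%N | w in [fset v x | x in I]]%M.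

Lemma monom_ofE mu w : monom_of mu w = (\sum_(x | v x == w) mu x)%N.
Proof.
rewrite /monom_of cmE fsfun_fun; case: ifPn => // wN.
rewrite big1// => x /eqP xw.
by case/negP: wN; apply/imfsetP; exists x.
Qed.

Lemma monom_of_v mu x : monom_of mu (v x) = mu x.
Proof.
rewrite monom_ofE (big_pred1 x)// => y; exact: inj_eq.
Qed.

Lemma monom_of_out mu w : w \notin codom v -> monom_of mu w = 0%N.
Proof.
move=> wN; rewrite monom_ofE big1// => x /eqP xw.
by case/negP: wN; rewrite -xw codom_f.
Qed.

Lemma eq_monom_of mu (m : {cmonom var}) :
  (forall w, w \notin codom v -> m w = 0%N) -> (forall x, m (v x) = mu x) ->
  m = monom_of mu.
Proof.
move=> mN mv; apply/eqP/cmP => w.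
have [/codomP[x ->]|wN] := boolP (w \in codom v).
  by rewrite monom_of_v mv.
by rewrite mN// monom_of_out.
Qed.

Definition sqf_monom (A : {set I}) := monom_of (fun x => x \in A).

Lemma finsupp_sqf_monom A :
  perm_eq (finsupp (sqf_monom A)) [seq v x | x <- enum A].
Proof.
apply: uniq_perm; first exact: fset_uniq.
  by rewrite map_inj_uniq ?enum_uniq.
move=> w; rewrite -cmE_neq0.
have [/codomP[x ->]|wN] := boolP (w \in codom v).
  by rewrite monom_of_v mem_map// mem_enum; case: (x \in A).
rewrite monom_of_out//; apply/esym/negP => /mapP[x _ xw].
by case/negP: wN; rewrite xw codom_f.
Qed.

Lemma squarefree_sqf_monom A : squarefree (sqf_monom A).
Proof.
apply/allP => w; rewrite (perm_mem (finsupp_sqf_monom A)) => /mapP[x xA ->].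
by rewrite monom_of_v -(mem_enum A) xA.
Qed.

Lemma mondeg_sqf_monom A : mondeg (sqf_monom A) = (\sum_(x in A) vdeg (v x))%N.
Proof.
rewrite /mondeg (perm_big _ (finsupp_sqf_monom A)) big_map big_enum /=.
by apply: eq_bigr => x xA; rewrite monom_of_v xA muln1.
Qed.

Lemma squarefreeE (q : {cmonom var}) : squarefree q ->
  (forall w, w \notin codom v -> q w = 0%N) ->
  q = sqf_monom [set x | q (v x) != 0%N]%SET.
Proof.
move=> /allP sq qN; apply: eq_monom_of => // x; rewrite inE.
have [->//|/negPf q0] := eqVneq (q (v x)) 0%N.
by apply/eqP/sq; rewrite -cmE_neq0 q0.
Qed.

End MonomOf.

(** * The coefficients of a product of elementary functions *)

(** The weight [e] of a variable is a parameter to have the two families at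
    once: [e = 1] for E^+ and [e = -1] for E. *)
Definition E_wt_deg (e : rat) (d : nat) : series := fun m =>
  e ^+ size (finsupp m) * (squarefree m && (mondeg m == d))%:R.

Lemma E_wt_deg_sqf_monom (I : finType) (v : I -> var) e d (A : {set I}) :
  injective v ->
  E_wt_deg e d (sqf_monom v A) =
    e ^+ #|A| * ((\sum_(x in A) vdeg (v x))%N == d)%:R.
Proof.
move=> v_inj; rewrite /E_wt_deg squarefree_sqf_monom// mondeg_sqf_monom//=.
by rewrite (perm_size (finsupp_sqf_monom v_inj A)) size_map -cardE.
Qed.

Definition E_wt (e : rat) (sigma : seq block) : series :=
  \big[smul/sone]_(b <- sigma) spow b.2 (E_wt_deg e b.1).

(** Only square-free monomials contribute to the first factor. In a
    factorisation of [m] the first factor is thus an r-th power of a product of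
    distinct variables of [m], i.e. it is given by a set [A] of indices, and
    the second factor is the quotient, which exists when the exponents on [A]
    are at least [r]. *)
Lemma smul_spow_E_wt (I : finType) (v : I -> var) (mu : I -> nat) e d r
    (g : series) :
  injective v -> (0 < r)%N ->
  smul (spow r (E_wt_deg e d)) g (monom_of v mu) =
  \sum_(A : {set I} | ((\sum_(x in A) vdeg (v x))%N == d)
                       && [forall x in A, (r <= mu x)%N])
     e ^+ #|A| * g (monom_of v (fun x => mu x - r * (x \in A))%N).
Proof.
move=> v_inj r0.
pose h (A : {set I}) := (expcmn (sqf_monom v A) r,
                         monom_of v (fun x => mu x - r * (x \in A))%N).
have h_inj : injective h.
  move=> A A' [/(expcmn_inj r0) /eqP/cmP AA _].
  apply/setP => x; move: (AA (v x)).
  by rewrite !monom_of_v//; do 2!case: (_ \in _).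
pose D := [set A : {set I} | [forall x in A, (r <= mu x)%N]]%classic.
(* The sum over all factorisations reduces to those of the form [h A]. *)
rewrite /smul -(fsbig_widen (h @` D)%classic)/=; first last.
- move=> [p q] /= [pq ND]; apply: contra_notP ND => /eqP.
  rewrite mulf_eq0 negb_or => /andP[/spow_neq0[s [ps]] + _].
  rewrite /E_wt_deg mulf_eq0 negb_or => /andP[_].
  rewrite pnatr_eq0 eqb0 negbK => /andP[sqs _].
  have sumE w : monom_of v mu w = (r * s w + q w)%N.
    by rewrite -pq mulcmE ps expcmnE.
  have sN w : w \notin codom v -> s w = 0%N.
    move=> wN; move: (sumE w); rewrite monom_of_out// => /esym/eqP.
    by rewrite addn_eq0 muln_eq0 eqn0Ngt r0 => /andP[/eqP->].
  have qN w : w \notin codom v -> q w = 0%N.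
    move=> wN; move: (sumE w); rewrite monom_of_out// => /esym/eqP.
    by rewrite addn_eq0 => /andP[_ /eqP].
  exists [set x | s (v x) != 0%N]%SET.
    apply/forall_inP => x; rewrite inE -lt0n => s0.
    rewrite -(monom_of_v v_inj mu) sumE (leq_trans _ (leq_addr _ _))//.
    exact: leq_pmulr.
  rewrite /h -squarefreeE// -ps; congr pair; apply/esym/eq_monom_of => // x.
  have -> : nat_of_bool (x \in [set x | s (v x) != 0%N]%SET) = s (v x).
    by rewrite {2}(squarefreeE v_inj sqs sN) monom_of_v.
  by rewrite -(monom_of_v v_inj mu) sumE addKn.
- move=> _ [A /forall_inP DA <-] /=; apply: eq_monom_of => //= [w wN|x].
    by rewrite mulcmE expcmnE !monom_of_out// muln0.
  rewrite mulcmE expcmnE !monom_of_v// subnKC//.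
  by have [/DA|] := boolP (x \in A); rewrite ?muln1 ?muln0.
rewrite fsbig_image; last by move=> ? ? _ _; exact: h_inj.
pose P := [pred A : {set I} | [forall x in A, (r <= mu x)%N]].
rewrite (_ : D = [set` P]%classic)//.
rewrite -(@bigfs _ _ _ _ (index_enum _)) ?index_enum_uniq//; last first.
  by move=> A _; rewrite mem_index_enum.
rewrite big_mkcond [RHS]big_mkcond; apply: eq_bigr => A _ /=.
rewrite spow_expcmn// E_wt_deg_sqf_monom//.
case: eqP => _; first by rewrite mulr1.
by rewrite mulr0 mul0r if_same.
Qed.

(** A family indexed by [n.+1] labels is its first member together with the
    family of the others: this lets the sums over families of sets follow the
    recursion on the list of blocks. *)
Lemma big_ffun_ordS (R : Type) (idx : R) (op : Monoid.com_law idx)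
    (T : finType) n (F : {ffun 'I_n.+1 -> T} -> R) :
  \big[op/idx]_B F B =
  \big[op/idx]_(A : T) \big[op/idx]_(B : {ffun 'I_n -> T})
     F [ffun i => if unlift ord0 i is Some j then B j else A].
Proof.
rewrite pair_big /=.
rewrite (reindex (fun p : T * {ffun 'I_n -> T} =>
  [ffun i => if unlift ord0 i is Some j then p.2 j else p.1]))//=.
exists (fun B : {ffun 'I_n.+1 -> T} => (B ord0, [ffun j => B (lift ord0 j)])).
  move=> [A B] _ /=; rewrite ffunE unlift_none; congr pair.
  by apply/ffunP => j; rewrite !ffunE liftK.
move=> B _; apply/ffunP => i; rewrite ffunE /=.
by case: unliftP => [j ->|->]; rewrite ?ffunE.
Qed.

(** [B i] is the set of the indices (variables of a monomial, or rows of a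
    diagram) used by the [i]-th block of [sigma]. *)
Definition fills (I : finType) (mu : I -> nat) (sigma : seq block)
    (B : {ffun 'I_(size sigma) -> {set I}}) : bool :=
  [forall x, (\sum_(i | x \in B i) (block_at i).2)%N == mu x].

Definition is_incidence (I : finType) (deg mu : I -> nat) (sigma : seq block)
    (B : {ffun 'I_(size sigma) -> {set I}}) : bool :=
  fills mu B && [forall i, (\sum_(x in B i) deg x)%N == (block_at i).1].

(** Peeling off the first block [(d, r)] of [sigma] chooses the set [A] and
    lowers by [r] the exponents on [A]; the truncated subtraction is exact
    there because [r <= mu x] for [x] in [A]. *)
Lemma E_wt_monom_of (I : finType) (v : I -> var) (mu : I -> nat) e sigma :
  injective v -> all (fun b => 0 < b.2)%N sigma ->
  E_wt e sigma (monom_of v mu) =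
  \sum_(B : {ffun 'I_(size sigma) -> {set I}}
          | is_incidence (fun x => vdeg (v x)) mu B) \prod_i e ^+ #|B i|.
Proof.
move=> v_inj; elim: sigma mu => [|[d r] sigma IH] mu /=.
  move=> _; rewrite /E_wt big_nil /sone.
  under eq_bigr do rewrite big_ord0.
  rewrite sumr_const; congr (_ %:R).
  set P := [forall x, 0%N == mu x].
  have -> : (monom_of v mu == mone) = P.
    apply/cmP/forallP => H x.
      by have := H (v x); rewrite monom_of_v// cm1 => ->.
    by rewrite monom_ofE cm1 big1// => y _; apply/esym/eqP.
  rewrite (@eq_card _ _ (fun=> P)); last first.
    move=> B; rewrite -!topredE /= /is_incidence /fills.
    rewrite [X in _ && X](_ : _ = true) ?andbT; last by apply/forallP => -[].
    by apply: eq_forallb => x; rewrite big_ord0.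
  case: P; last by rewrite card0.
  by rewrite (eq_card (B := predT))// card_ffun card_ord expn0.
move=> /andP[r0 sigma0].
rewrite /E_wt big_cons smul_spow_E_wt// -/(E_wt e sigma).
rewrite [RHS]big_mkcond big_ffun_ordS [LHS]big_mkcond; apply: eq_bigr => A _.
rewrite -big_mkcond /=.
pose ext (B : {ffun 'I_(size sigma) -> {set I}}) :
    {ffun 'I_(size sigma).+1 -> {set I}} :=
  [ffun i => if unlift ord0 i is Some j then B j else A].
have extE B :
    is_incidence (sigma := (d, r) :: sigma) (fun x => vdeg (v x)) mu (ext B)
  = [&& (\sum_(x in A) vdeg (v x))%N == d, [forall x in A, (r <= mu x)%N]
      & is_incidence (fun x => vdeg (v x))
          (fun x => mu x - r * (x \in A))%N B].
  have ext0 : ext B ord0 = A by rewrite ffunE unlift_none.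
  have extS j : ext B (lift ord0 j) = B j by rewrite ffunE liftK.
  have sumE x : (\sum_(i | x \in ext B i) (@block_at ((d, r) :: sigma) i).2)%N =
     (r * (x \in A) + \sum_(i | x \in B i) (block_at i).2)%N.
    rewrite big_mkcond big_ord_recl ext0 /= [in RHS]big_mkcond; congr addn.
      by case: (x \in A); rewrite ?muln1 ?muln0.
    by apply: eq_bigr => j _; rewrite extS.
  apply/andP/and3P => [[/forallP H1 /forallP H2]|[H1 /forall_inP H2]].
    split.
    - by have := H2 ord0; rewrite ext0.
    - apply/forall_inP => x xA; rewrite -(eqP (H1 x)) sumE xA muln1.
      exact: leq_addr.
    - apply/andP; split; apply/forallP => x.
        by rewrite -(eqP (H1 x)) sumE addKn.
      by have := H2 (lift ord0 x); rewrite extS.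
  move=> /andP[/forallP H3 /forallP H4]; split; apply/forallP => x.
    rewrite sumE (eqP (H3 x)) subnKC//.
    by have [/H2|] := boolP (x \in A); rewrite ?muln1 ?muln0.
  case: (unliftP ord0 x) => [j ->|->]; rewrite ?ext0// extS; exact: (H4 j).
under [RHS]eq_bigl => B do rewrite [is_incidence _ _ _]extE.
case: eqP => _; last by rewrite big_pred0.
case: forall_inP => _; last by rewrite big_pred0.
rewrite IH// mulr_sumr; apply: eq_bigr => B _.
rewrite big_ord_recl ffunE unlift_none; congr (_ * _).
by apply: eq_bigr => j _; rewrite ffunE liftK.
Qed.

(** * Types and the tensor monomial functions *)

Lemma block_ge_total : total block_ge.
Proof.
move=> [a b] [c d]; rewrite /block_ge /= (eq_sym c a).
by case: ltngtP => //= _; exact: leq_total.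
Qed.

Lemma block_ge_trans : transitive block_ge.
Proof.
move=> [a b] [c d] [e f]; rewrite /block_ge /=.
case/orP => [ac|/andP[/eqP<- bd]] /orP[ae|/andP[/eqP<- bf]].
- by rewrite (ltn_trans ae ac).
- by rewrite ac.
- by rewrite ae.
- by rewrite eqxx (leq_trans bf bd) orbT.
Qed.

Lemma block_ge_anti : antisymmetric block_ge.
Proof.
move=> [a b] [c d]; rewrite /block_ge /= (eq_sym c a).
case: ltngtP => //= ->; rewrite andbC => bd; congr pair; exact: anti_leq.
Qed.

Definition blocks (m : {cmonom var}) : seq block :=
  [seq (vdeg v, m v) | v <- finsupp m].

Definition mtype (m : {cmonom var}) : seq block := sort block_ge (blocks m).

Lemma perm_mtype m : perm_eq (mtype m) (blocks m).
Proof. by rewrite perm_sort. Qed.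

Lemma mtype_is_type m : is_type (mtype m).
Proof.
rewrite /is_type sort_sorted ?andbT; last exact: block_ge_total.
rewrite (perm_all _ (perm_mtype m)) all_map; apply/allP => v /=.
by rewrite -cmE_neq0 lt0n.
Qed.

Lemma weight_mtype m : weight (mtype m) = mondeg m.
Proof. by rewrite /weight (perm_big _ (perm_mtype m)) big_map. Qed.

Lemma mtype_eq m tau : is_type tau -> (mtype m == tau) = perm_eq (blocks m) tau.
Proof.
move=> /andP[_ tau_s]; apply/eqP/idP => [<-|mt].
  by rewrite perm_sym perm_mtype.
apply: (sorted_eq block_ge_trans block_ge_anti) => //.
  exact: sort_sorted block_ge_total _.
exact: perm_trans (perm_mtype m) mt.
Qed.

Lemma restr_sorted tau k : is_type tau -> sorted geq (restr tau k).
Proof.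
move=> /andP[_ tau_s]; rewrite /restr sorted_map.
have := sorted_filter block_ge_trans (fun b => b.1 == k) tau_s.
apply: (sub_in_sorted (P := fun b => b.1 == k)); last exact: filter_all.
move=> b c /eqP b1 /eqP c1; rewrite /block_ge b1 c1 ltnn eqxx /=.
exact.
Qed.

Definition mrestr (P : pred var) (m : {cmonom var}) : {cmonom var} :=
  [cmonom (if P v then m v else 0) | v in finsupp m]%M.

Lemma mrestrE P m v : mrestr P m v = if P v then m v else 0%N.
Proof.
rewrite /mrestr cmE fsfun_fun; case: finsuppP => //; by rewrite if_same.
Qed.

Lemma finsupp_mrestr P m :
  perm_eq (finsupp (mrestr P m)) [seq v <- finsupp m | P v].
Proof.
apply: uniq_perm => [||v]; rewrite ?filter_uniq ?fset_uniq// mem_filter.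
by rewrite -!cmE_neq0 mrestrE; case: (P v).
Qed.

Lemma restr_blocks m k :
  restr (blocks m) k = [seq m v | v <- finsupp m & vdeg v == k].
Proof. by rewrite /restr filter_map -map_comp. Qed.

(** This form is stable under products over several degrees, where the
    exponents must be sorted out by degree. *)
Lemma msymE lam k m :
  msym lam k m = (all (fun v => vdeg v == k) (finsupp m) &&
                   perm_eq (restr (blocks m) k) lam)%:R.
Proof.
rewrite /msym restr_blocks.
case: (boolP (all _ _)) => //= allk; congr (perm_eq _ _)%:R.
by rewrite (all_filterP _)//.
Qed.

Lemma restr_mrestr (P : pred nat) m k : P k ->
  perm_eq (restr (blocks (mrestr (P \o vdeg) m)) k) (restr (blocks m) k).
Proof.
move=> Pk; rewrite !restr_blocks.
have H := finsupp_mrestr (P \o vdeg) m.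
rewrite (perm_trans (perm_map _ (perm_filter _ H)))// -filter_predI.
rewrite (eq_filter (a2 := fun v => vdeg v == k)); last first.
  by move=> v /=; case: eqP => // ->.
rewrite (eq_in_map _ (fun v => m v) _).1// => v.
by rewrite mem_filter mrestrE => /andP[/eqP /= -> _]; rewrite Pk.
Qed.

(** The factors involve disjoint sets of variables, so the only factorisation
    of [m] that contributes is the one that separates the variables by degree;
    the coefficients of the product are therefore 0 or 1. *)
Lemma big_smul_msym (lam : nat -> seq nat) (ks : seq nat) m : uniq ks ->
  (\big[smul/sone]_(k <- ks) msym (lam k) k) m =
  (all (fun v => vdeg v \in ks) (finsupp m)
   && all (fun k => perm_eq (restr (blocks m) k) (lam k)) ks)%:R.
Proof.
elim: ks m => [|k ks IH] m /=.
  move=> _; rewrite big_nil /sone andbT; congr (nat_of_bool _)%:R.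
  apply/eqP/allP => [->|m0]; first by rewrite mdom1.
  apply/eqP/cmP => v; rewrite cm1; apply/eqP/negPn/negP.
  by rewrite cmE_neq0 => /m0.
move=> /andP[kN ks_u]; rewrite big_cons /smul.
set G := \big[_/_]_(_ <- _) _.
pose p := mrestr (pred1 k \o vdeg) m; pose q := mrestr (predC1 k \o vdeg) m.
rewrite -(fsbig_widen [set (p, q)]%classic)/=; first last.
- move=> [p' q'] /= [pq]; apply: contra_notP => /eqP.
  rewrite /G IH// msymE -natrM mulnb pnatr_eq0 eqb0 negbK.
  move=> /andP[/andP[/allP pk _] /andP[/allP qk _]].
  have sumE v : m v = (p' v + q' v)%N by rewrite -pq mulcmE.
  have p0 v : vdeg v != k -> p' v = 0%N.
    by move=> vk; apply/eqP; rewrite cmE_eq0; apply: contra vk => /pk.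
  have q0 v : vdeg v = k -> q' v = 0%N.
    move=> vk; apply/eqP; rewrite cmE_eq0; apply: contra kN => /qk.
    by rewrite vk.
  congr pair; apply/eqP/cmP => v; rewrite mrestrE /= sumE.
    by case: eqP => [/q0->|/eqP/p0]; rewrite ?addn0.
  by case: eqP => [/q0|/eqP/p0] ->.
- move=> _ ->; apply/eqP/cmP => v; rewrite mulcmE !mrestrE /=.
  by case: eqP; rewrite ?addn0.
rewrite fsbig_set1 /G IH// msymE -natrM mulnb; congr (nat_of_bool _)%:R.
have restrp : perm_eq (restr (blocks p) k) (restr (blocks m) k).
  by apply: restr_mrestr => /=.
have -> : all (fun v => vdeg v == k) (finsupp p).
  by rewrite (perm_all _ (finsupp_mrestr _ _)) filter_all.
rewrite (permPl restrp) andTb.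
have -> : all (fun v => vdeg v \in ks) (finsupp q) = 
          all (fun v => vdeg v \in k :: ks) (finsupp m).
  rewrite (perm_all _ (finsupp_mrestr _ _)) all_filter; apply: eq_all => v /=.
  by rewrite inE; case: eqP.
rewrite andbCA; congr (_ && (_ && _)); apply: eq_in_all => l lks.
rewrite (permPl (_ : perm_eq _ (restr (blocks m) l)))//.
by apply: restr_mrestr => /=; apply: contraNneq kN => <-.
Qed.

(** The multiplicity of a block [(k, a)] is that of [a] in the [k]-th
    restriction. *)
Lemma perm_restr (s t : seq block) :
  (forall k, perm_eq (restr s k) (restr t k)) -> perm_eq s t.
Proof.
move=> H; apply/allP => -[k a] _ /=; apply/eqP.
have cnt u : count_mem (k, a) u = count_mem a (restr u k).
  rewrite /restr count_map count_filter; apply: eq_count => -[k' a'] /=.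
  by rewrite xpair_eqE andbC.
by rewrite !cnt; apply/permP.
Qed.

Lemma mem_type tau b : is_type tau -> b \in tau ->
  [/\ (0 < b.1)%N, (0 < b.2)%N & (b.1 * b.2 <= weight tau)%N].
Proof.
move=> /andP[/allP tau_p _] bt; have /andP[b1 b2] := tau_p _ bt; split=> //.
by rewrite /weight (big_rem b)//= leq_addr.
Qed.

Lemma mtensorE tau m : is_type tau -> mtensor tau m = (mtype m == tau)%:R.
Proof.
move=> tau_t; rewrite mtype_eq// /mtensor big_smul_msym ?iota_uniq//.
congr (nat_of_bool _)%:R; apply/andP/idP => [[/allP mk /allP mt]|mt].
  apply: perm_restr => k.
  have [/mt//|kN] := boolP (k \in index_iota 1 (weight tau).+1).
  have -> : restr (blocks m) k = [::].
    rewrite restr_blocks (@eq_in_filter _ _ pred0) ?filter_pred0// => v /mk.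
    by move=> vk; apply: contraNF kN => /eqP <-.
  suff -> : restr tau k = [::] by [].
  rewrite /restr (@eq_in_filter _ _ pred0) ?filter_pred0// => b bt /=.
  apply: contraNF kN => /eqP <-; have [b1 b2 bw] := mem_type tau_t bt.
  by rewrite mem_index_iota b1 ltnS (leq_trans _ bw)// leq_pmulr.
split; apply/allP; [move=> v vm | move=> k _]; last first.
  exact/perm_map/perm_filter.
have: (vdeg v, m v) \in tau by rewrite -(perm_mem mt); apply: map_f.
move=> /(mem_type tau_t)[/= b1 b2 bw].
by rewrite mem_index_iota b1 ltnS (leq_trans _ bw)// leq_pmulr.
Qed.

(** Exactly one tensor monomial function is nonzero at [m], namely the one of
    the type of [m]. *)
Lemma is_expansionP n (f : series) c : is_expansion n f c <->
  forall m, f m = if mondeg m == n then c (mtype m) else 0.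
Proof.
suff H m : \sum_(tau \in [set tau : seq block | type_of n tau]%classic)
   c tau * mtensor tau m = if mondeg m == n then c (mtype m) else 0.
  by split=> fc m; rewrite fc// H.
case: ifPn => mn.
  rewrite -(fsbig_widen [set mtype m]%classic)/=; first last.
  - move=> tau [/= /andP[tau_t _] /eqP tm].
    by rewrite mtensorE// eq_sym (negPf tm) mulr0.
  - by move=> _ ->; rewrite /type_of /= mtype_is_type weight_mtype.
  by rewrite fsbig_set1 mtensorE ?mtype_is_type// eqxx mulr1.
apply: fsbig1 => tau /= /andP[tau_t /eqP tn]; rewrite mtensorE//.
case: eqP => [mt|]; last by rewrite mulr0.
by case/negP: mn; rewrite -weight_mtype mt tn.
Qed.

(** Numbering the variables by the positions in [tau] keeps apart the
    blocks that are repeated. *)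
Lemma mtype_surj tau : is_type tau -> exists m, mtype m = tau.
Proof.
move=> tau_t; pose b (i : 'I_(size tau)) := nth (0, 0)%N tau i.
have bP i : (0 < (b i).1)%N && (0 < (b i).2)%N.
  by have [-> ->] := mem_type tau_t (mem_nth (0, 0)%N (ltn_ord i)).
pose v (i : 'I_(size tau)) : var := ((b i).1.-1, i : nat).
have v_inj : injective v by move=> i j [_ /val_inj].
pose m := monom_of v (fun i => (b i).2).
exists m; apply/eqP; rewrite mtype_eq//.
have supp : perm_eq (finsupp m) [seq v i | i <- enum 'I_(size tau)].
  apply: uniq_perm => [||w]; first exact: fset_uniq.
    by rewrite map_inj_uniq ?enum_uniq.
  rewrite -cmE_neq0; have [/codomP[i ->]|wN] := boolP (w \in codom v).
    by rewrite monom_of_v//; have /andP[_] := bP i; rewrite -lt0n.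
  by rewrite monom_of_out.
rewrite /blocks (perm_trans (perm_map _ supp))// -map_comp.
rewrite (eq_map (g := nth (0, 0)%N tau \o val)).
  by rewrite map_comp val_enum_ord map_nth_iota0// take_size.
move=> i; rewrite /= monom_of_v// /vdeg prednK; last by case/andP: (bP i).
by rewrite /b -surjective_pairing.
Qed.

(** The expansion is unique: its coefficient at [tau] is the coefficient of
    the series at any monomial of type [tau]. *)
Lemma mtensor_coefE n f c tau : is_expansion n f c -> type_of n tau ->
  mtensor_coef n f tau = c tau.
Proof.
move=> fc /andP[tau_t /eqP tau_n].
have /(xgetPex (fun=> 0)) : exists c, is_expansion n f c by exists c.
rewrite /mtensor_coef; set c' := xget _ _ => /= fc'.
have [m mtau] := mtype_surj tau_t.
move: fc fc' => /is_expansionP/(_ m) + /is_expansionP/(_ m).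
by rewrite -weight_mtype mtau tau_n eqxx => -> ->.
Qed.

(** * Intervals and partial sums *)

Lemma sum_interval C a r :
  (a + r <= C)%N -> (\sum_(c < C) (a <= c < a + r) = r)%N.
Proof.
move=> arC.
rewrite -(big_mkord xpredT (fun c => nat_of_bool (a <= c < a + r)))%N.
rewrite (big_cat_nat (n := a)) ?(leq_trans _ arC) ?leq_addr//=.
rewrite big_nat big1 => [|c /= ca]; last by rewrite leqNgt ca.
rewrite (big_cat_nat (n := a + r)) ?leq_addr//= big_nat.
rewrite (eq_bigr (fun=> 1%N)) => [|c ->//].
rewrite -big_nat sum_nat_const_nat muln1 addKn.
rewrite big_nat big1 => [|c /= /andP[ca _]]; first by rewrite addn0.
by rewrite ltnNge ca andbF.
Qed.

Definition partial_sum s (w : 'I_s -> nat) (n : nat) : nat :=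
  (\sum_(j < s | j < n) w j)%N.

Lemma partial_sum_mono s (w : 'I_s -> nat) :
  {homo partial_sum w : m n / (m <= n)%N}.
Proof.
move=> m n mn; rewrite /partial_sum [leqRHS]big_mkcond [leqLHS]big_mkcond.
by apply: leq_sum => j _; case: ifP => // jm; rewrite (leq_trans jm mn).
Qed.

Lemma partial_sumS s (w : 'I_s -> nat) (i : 'I_s) :
  partial_sum w i.+1 = (partial_sum w i + w i)%N.
Proof.
rewrite /partial_sum (bigD1 i)//= addnC; congr addn; apply: eq_bigl => j.
by rewrite ltnS ltn_neqAle andbC.
Qed.

Lemma partial_sum_total s (w : 'I_s -> nat) : partial_sum w s = (\sum_j w j)%N.
Proof. by apply: eq_bigl => j; rewrite ltn_ord. Qed.

(** The intervals between successive partial sums tile the interval from 0 to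
    the total: every point is in exactly one of them. *)
Lemma partial_sum_stab s (w : 'I_s -> nat) c :
  (\sum_(i < s) (partial_sum w i <= c < partial_sum w i + w i) =
     (c < \sum_i w i))%N.
Proof.
rewrite -partial_sum_total; under eq_bigr => i _ do rewrite -partial_sumS.
pose stab i := nat_of_bool (partial_sum w i <= c < partial_sum w i.+1)%N.
rewrite -(big_mkord xpredT stab) {}/stab.
suff H n : (\sum_(0 <= i < n) (partial_sum w i <= c < partial_sum w i.+1) =
            (c < partial_sum w n))%N by exact: H.
elim: n => [|n IH].
  by rewrite big_geq// /partial_sum big_pred0.
rewrite big_nat_recr//= IH.
have := partial_sum_mono w (leqnSn n).
by case: (ltnP c (partial_sum w n)) => /= [cn /(leq_trans cn)->|_ _].
Qed.

(** * Tabloids and incidence families *)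

Section Tabloids.
Variables (tau sigma : seq block) (I : finType).
Let W := weight tau.
(* The rows are indexed by an abstract type, as it will be the set of variables
   of a monomial; [pos x] is the pair (component, row within it). *)
Variable pos : I -> 'I_W.+1 * 'I_W.+1.
Definition rowlen (x : I) : nat := row_length tau (pos x).1 (pos x).2.
Hypothesis pos_inj : injective pos.
Hypothesis pos_gt0 : forall x, (0 < (pos x).1)%N.
Hypothesis pos_surj : forall k i : 'I_W.+1,
  (0 < k)%N -> (0 < row_length tau k i)%N -> exists x, pos x = (k, i).
Hypothesis rowlen_le : forall x, (rowlen x <= W)%N.
Let blen (l : 'I_(size sigma)) : nat := (block_at l).2.
Hypothesis blen_gt0 : forall l, (0 < blen l)%N.

Implicit Types (B : {ffun 'I_(size sigma) -> {set I}}).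
Implicit Types (T : {set brick tau sigma}).

Definition row_weight B (x : I) (l : 'I_(size sigma)) : nat :=
  if x \in B l then (block_at l).2 else 0%N.

Definition offset B x (l : 'I_(size sigma)) : nat :=
  partial_sum (row_weight B x) l.

Definition label_rows T : {ffun 'I_(size sigma) -> {set I}} :=
  [ffun l => [set x | [exists b in T, (b.1.1 == pos x) && (b.2 == l)]]%SET].

(** The bricks of a row are laid end to end by increasing label. *)
Definition tabloid_of B : {set brick tau sigma} :=
  [set b | [exists x in B b.2,
     (pos x == b.1.1) && (cell_col b.1 == offset B x b.2)]]%SET.

Lemma same_rowE (y z : cell tau) : same_row y z = (y.1 == z.1).
Proof. by case: y => [[a b] c]; case: z => [[a' b'] c']. Qed.

Lemma in_label_rows T l x :
  reflect (exists b, [/\ b \in T, b.1.1 = pos x & b.2 = l])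
    (x \in label_rows T l).
Proof.
rewrite ffunE inE; apply: (iffP (exists_inP)) => [[b bT]|[b [bT p q]]].
  by move=> /andP[/eqP p /eqP q]; exists b.
by exists b => //; rewrite p q !eqxx.
Qed.

Lemma in_tabloid_of B b :
  reflect (exists x, [/\ x \in B b.2, b.1.1 = pos x
                        & cell_col b.1 = offset B x b.2])
    (b \in tabloid_of B).
Proof.
rewrite inE; apply: (iffP (exists_inP)) => [[x xB]|[x [bT p q]]].
  by move=> /andP[/eqP p /eqP q]; exists x.
by exists x => //; rewrite p q !eqxx.
Qed.

Lemma brick_eq (b c : brick tau sigma) :
  b.1.1 = c.1.1 -> cell_col b.1 = cell_col c.1 -> b.2 = c.2 -> b = c.
Proof.
by case: b c => [[? ?] ?] [[? ?] ?] /= -> /val_inj /= -> ->.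
Qed.

Section Standard.
Variable T : {set brick tau sigma}.
Hypotheses (T_cov : is_covering T) (T_lab : labels_increase T).

Lemma cover_unique (b c : brick tau sigma) y :
  b \in T -> c \in T -> y \in diagram tau -> covers b y -> covers c y -> b = c.
Proof.
move=> bT cT yD bc cc.
move: T_cov => /andP[_ /forall_inP /(_ _ yD) /cards1P[z zE]].
have: b \in [set b in T | covers b y]%SET by rewrite inE bT.
have: c \in [set b in T | covers b y]%SET by rewrite inE cT.
by rewrite !zE !inE => /eqP-> /eqP->.
Qed.

Lemma brick_fits b : b \in T -> b.1 \in diagram tau /\
  (cell_col b.1 + brick_length b <= row_length tau b.1.1.1 b.1.1.2)%N.
Proof. by move=> bT; move: T_cov => /andP[/forall_inP/(_ _ bT)/andP[]]. Qed.

Lemma covers_start (b : brick tau sigma) : covers b b.1.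
Proof.
by rewrite /covers same_rowE eqxx leqnn /= -[leqLHS]addn0 ltn_add2l blen_gt0.
Qed.

Lemma col_inj b c : b \in T -> c \in T -> b.1.1 = c.1.1 ->
  cell_col b.1 = cell_col c.1 -> b = c.
Proof.
move=> bT cT rowE colE; apply: (@cover_unique b c b.1) => //.
- by case: (brick_fits bT).
- exact: covers_start.
suff -> : b.1 = c.1 by exact: covers_start.
by case: (b.1) (c.1) rowE colE => [? ?] [? ?] /= -> /val_inj /= ->.
Qed.

(** The converse of the increase of labels: two bricks that start in the same
    box coincide, and distinct starts are ordered like the labels. *)
Lemma label_lt b c : b \in T -> c \in T -> b.1.1 = c.1.1 ->
  (cell_col b.1 < cell_col c.1)%N = (b.2 < c.2)%N.
Proof.
have lab b' c' : b' \in T -> c' \in T -> b'.1.1 = c'.1.1 ->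
    (cell_col b'.1 < cell_col c'.1)%N -> (b'.2 < c'.2)%N.
  move=> bT cT rowE colE.
  move: T_lab => /forall_inP/(_ _ bT)/forall_inP/(_ _ cT).
  by rewrite same_rowE rowE eqxx colE.
move=> bT cT rowE; apply/idP/idP => [|bc]; first exact: lab.
case: ltngtP => // [cb|colE].
  by move: (lab _ _ cT bT (esym rowE) cb); rewrite ltnNge ltnW.
by move: bc; rewrite (col_inj bT cT rowE colE) ltnn.
Qed.

(** A label occurs at most once in a row, so nothing is lost when a row is
    replaced by its set of labels. *)
Lemma label_inj b c : b \in T -> c \in T -> b.1.1 = c.1.1 -> b.2 = c.2 -> b = c.
Proof.
move=> bT cT rowE labE; apply: col_inj => //.
have := label_lt bT cT rowE; have := label_lt cT bT (esym rowE).
by rewrite labE ltnn; case: ltngtP.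
Qed.

Lemma brick_row b : b \in T -> exists x, b.1.1 = pos x.
Proof.
move=> /brick_fits[]; rewrite inE => /andP[k0 cl] _.
have [x xE] := pos_surj k0 (leq_ltn_trans (leq0n _) cl).
by exists x; rewrite xE -surjective_pairing.
Qed.

(* double counting *)
(** Double counting of the pairs (box, brick that covers it) among the first
    [C] boxes of a row: each box is covered once, and a brick that starts there
    covers as many of these boxes as its length, since none straddles [C]. *)
Lemma prefix_length x C : (C <= rowlen x)%N ->
  (forall b, b \in T -> b.1.1 = pos x -> (cell_col b.1 < C)%N ->
     (cell_col b.1 + brick_length b <= C)%N) ->
  C = (\sum_(b in T | (b.1.1 == pos x) && (cell_col b.1 < C)) brick_length b)%N.
Proof.
move=> Cx nostr.
transitivity (\sum_(c < C) \sum_(b in T | b.1.1 == pos x)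
    (cell_col b.1 <= c < cell_col b.1 + brick_length b))%N.
  rewrite -[LHS]card_ord -sum1_card; apply: eq_bigr => c _.
  have cW : (c < W.+1)%N.
    by rewrite ltnS (leq_trans (ltnW (ltn_ord c)))// (leq_trans Cx).
  pose y : cell tau := (pos x, Ordinal cW).
  have yD : y \in diagram tau by rewrite inE pos_gt0 /= (leq_trans (ltn_ord c)).
  move: T_cov => /andP[_ /forall_inP /(_ _ yD) /eqP <-].
  rewrite -sum1_card big_mkcond [RHS]big_mkcondr [RHS]big_mkcond /=.
  apply: eq_bigr => b _; rewrite inE /covers same_rowE.
  rewrite -[y.1]/(pos x) -[cell_col y]/(c : nat).
  by case: (b \in T) => //=; case: eqP => //= _; case: ifP.
rewrite exchange_big /=; under [RHS]eq_bigl do rewrite andbA.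
rewrite [RHS]big_mkcondr /=; apply: eq_bigr => b /andP[bT /eqP bx].
case: ltnP => bC; first by apply/sum_interval/nostr.
by rewrite big1// => c _; rewrite leqNgt (leq_trans (ltn_ord c) bC).
Qed.

Lemma row_reindex x (P : pred 'I_(size sigma)) (f : 'I_(size sigma) -> nat) :
  (\sum_(b in T | (b.1.1 == pos x) && P b.2) f b.2 =
   \sum_(l | (x \in label_rows T l) && P l) f l)%N.
Proof.
pose A := [set b in T | (b.1.1 == pos x) && P b.2]%SET.
rewrite (eq_bigl (mem A)) => [|b]; last by rewrite !inE.
rewrite -(big_imset (h := fun b : brick tau sigma => b.2) f)/=; last first.
  move=> b c; rewrite !inE => /and3P[bT /eqP bx _] /and3P[cT /eqP cx _].
  by apply: label_inj => //; rewrite bx cx.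
apply: eq_bigl => l.
apply/imsetP/andP => [[b]|[/in_label_rows[b [bT bx <-]] Pl]].
  rewrite inE => /and3P[bT /eqP bx Pb] ->; split=> //.
  by apply/in_label_rows; exists b.
by exists b => //; rewrite inE bT bx eqxx.
Qed.

Lemma sum_row_weight B x (P : pred 'I_(size sigma)) :
  (\sum_(l | (x \in B l) && P l) blen l = \sum_(l | P l) row_weight B x l)%N.
Proof.
by rewrite /row_weight -big_mkcondr; apply: eq_bigl => l; rewrite andbC.
Qed.

(** No brick of the row straddles the start of [b], whose first box would be
    covered twice; so the boxes to the left of [b] are those of the bricks that
    start there, which are the bricks with a smaller label. *)
Lemma col_offset b x : b \in T -> b.1.1 = pos x ->
  cell_col b.1 = offset (label_rows T) x b.2.
Proof.
move=> bT bx; rewrite [LHS](@prefix_length x); first last.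
- move=> c cT cx cb; rewrite leqNgt; apply/negP => bc.
  suff cE : c = b by rewrite cE ltnn in cb.
  apply: (@cover_unique c b b.1) => //; first by case: (brick_fits bT).
    by rewrite /covers same_rowE cx bx eqxx ltnW.
  exact: covers_start.
- have [_] := brick_fits bT; rewrite bx; apply: leq_trans; exact: leq_addr.
rewrite /offset /partial_sum -sum_row_weight.
rewrite -(row_reindex _ (fun l => l < b.2)%N blen).
apply: eq_bigl => c; have [cT|//] := boolP (c \in T).
by case: eqP => //= cx; rewrite label_lt// cx bx.
Qed.

Lemma rowlen_label_rows x :
  (\sum_(l | x \in label_rows T l) blen l)%N = rowlen x.
Proof.
rewrite [RHS](@prefix_length x (rowlen x))//; last first.
  by move=> b bT bx _; have [_] := brick_fits bT; rewrite bx.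
under eq_bigl => l do rewrite -[_ \in _]andbT.
rewrite -(row_reindex _ xpredT blen).
apply: eq_bigl => c; have [cT|//] := boolP (c \in T).
case: eqP => //= cx; apply/esym.
by have [+ _] := brick_fits cT; rewrite inE /cell_comp /cell_row cx => /andP[].
Qed.

(** A brick is known from its row and its label, by [col_offset]. *)
Lemma label_rowsK : tabloid_of (label_rows T) = T.
Proof.
apply/setP => b; apply/in_tabloid_of/idP => [[x []]|bT].
  move=> /in_label_rows[c [cT cx cb]] bx bo.
  suff -> : b = c by [].
  apply: brick_eq; rewrite ?bx ?cx ?cb//.
  by rewrite bo (col_offset cT cx) cb.
have [x bx] := brick_row bT; exists x; split=> //; last exact: col_offset.
by apply/in_label_rows; exists b.
Qed.

End Standard.

Section Fill.
Variable B : {ffun 'I_(size sigma) -> {set I}}.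

Hypothesis B_fills : fills rowlen B.

Lemma offset_le x l : x \in B l -> (offset B x l + blen l <= rowlen x)%N.
Proof.
move=> xB; rewrite -(eqP (forallP B_fills x)).
have -> : blen l = row_weight B x l by rewrite /row_weight xB.
rewrite /offset -partial_sumS big_mkcond -[X in (_ <= X)%N]partial_sum_total.
exact: partial_sum_mono.
Qed.

Lemma offset_lt x l : x \in B l -> (offset B x l < W.+1)%N.
Proof.
move=> xB; rewrite ltnS (leq_trans _ (rowlen_le x))//.
by rewrite (leq_trans _ (offset_le xB))// leq_addr.
Qed.

(** The default value of [inord] is harmless: when [x] is in [B l] the offset
    is in range by [offset_lt]. *)
Definition brick_at x l : brick tau sigma := (pos x, inord (offset B x l), l).

Lemma brick_at_col x l : x \in B l -> cell_col (brick_at x l).1 = offset B x l.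
Proof. by move=> xB; rewrite /cell_col /= inordK// offset_lt. Qed.

Lemma brick_atP b :
  reflect (exists2 x, x \in B b.2 & b = brick_at x b.2) (b \in tabloid_of B).
Proof.
apply: (iffP (in_tabloid_of _ _)) => [[x [xB bx bo]]|[x xB ->]]; exists x => //.
  by apply: brick_eq; rewrite // brick_at_col.
by split=> //; rewrite brick_at_col.
Qed.

Lemma tabloid_ofK : label_rows (tabloid_of B) = B.
Proof.
apply/ffunP => l; apply/setP => x; apply/in_label_rows/idP => [[b []]|xB].
  by move=> /brick_atP[y yB ->] /pos_inj/= <- <-.
by exists (brick_at x l); split=> //; apply/brick_atP; exists x.
Qed.

Lemma tabloid_covering : is_covering (tabloid_of B).
Proof.
apply/andP; split.
  apply/forall_inP => b /brick_atP[x xB ->].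
  have le := offset_le xB.
  have lt : (offset B x b.2 < rowlen x)%N.
    by rewrite (leq_trans _ le)// -[X in (X < _)%N]addn0 ltn_add2l.
  apply/andP; split; last by rewrite brick_at_col.
  by rewrite inE brick_at_col// pos_gt0.
apply/forall_inP => -[[k i] c]; rewrite inE => /andP[k0 /= cl].
have [x xE] := pos_surj k0 (leq_ltn_trans (leq0n _) cl).
have {}cl : (c < rowlen x)%N by rewrite /rowlen xE.
(* The box [c] of the row lies in the interval of exactly one label; the
   labels absent from the row have empty intervals. *)
have := partial_sum_stab (row_weight B x) c.
rewrite -[X in (_ < X)%N]big_mkcond /= (eqP (forallP B_fills x)) cl => one.
pose L := [set l | (x \in B l)
                   && (offset B x l <= c < offset B x l + blen l)%N]%SET.
rewrite (_ : [set _ | _]%SET = [set brick_at x l | l in L]%SET); last first.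
  apply/setP => b; rewrite inE.
  apply/andP/imsetP => [[/brick_atP[y yB ->]]|[l]].
    rewrite /covers same_rowE brick_at_col//= -xE => /andP[/eqP/pos_inj yx].
    by rewrite yx in yB * => cc; exists b.2; rewrite // inE yB.
  rewrite inE => /andP[xB cc] ->; split; first by apply/brick_atP; exists x.
  by rewrite /covers same_rowE brick_at_col//= xE eqxx.
rewrite card_imset; last by move=> l l' [].
rewrite -sum1_card; apply/eqP; apply: etrans one.
rewrite big_mkcond; apply: eq_bigr => l _.
rewrite inE /row_weight; case: (x \in B l) => /=; first by case: ifP.
by rewrite addn0; case: leqP => // cc; rewrite ltnNge cc.
Qed.

Lemma tabloid_labels : labels_increase (tabloid_of B).
Proof.
apply/forall_inP => b /brick_atP[x xB ->].
apply/forall_inP => c /brick_atP[y yB ->].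
rewrite same_rowE !brick_at_col//=; apply/implyP => /andP[/eqP/pos_inj ->].
by apply: contraTT; rewrite -!leqNgt; exact: partial_sum_mono.
Qed.

Lemma tabloid_label_perm i :
  perm_eq [seq b.1.1 | b <- enum [set b in tabloid_of B | b.2 == i]%SET]
          [seq pos x | x <- enum (B i)].
Proof.
have -> : [set b in tabloid_of B | b.2 == i]%SET =
          [set brick_at x i | x in B i]%SET.
  apply/setP => b; rewrite inE.
  apply/andP/imsetP => [[/brick_atP[x xB ->] /eqP <-]|[x xB ->]].
    by exists x.
  by split=> //; apply/brick_atP; exists x.
have -> : [seq pos x | x <- enum (B i)] =
          [seq b.1.1 | b <- [seq brick_at x i | x <- enum (B i)]].
  by rewrite -map_comp.
apply: perm_map; apply: uniq_perm.
- exact: enum_uniq.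
- rewrite map_inj_uniq ?enum_uniq//.
  by move=> x y [/pos_inj].
move=> b; rewrite mem_enum; apply/imsetP/mapP => -[x xB ->]; exists x => //.
  by rewrite mem_enum.
by rewrite mem_enum in xB.
Qed.

(** The multiplicity of [k] in the partition chosen for the label [i] counts
    the bricks labelled [i] in the component [k], i.e. the rows of [B i] of
    degree [k]; so this partition is the sorted list of the degrees of the
    rows of [B i]. *)
Lemma content_perm lam : has_content lam (tabloid_of B) <->
  forall i, [/\ sorted geq (lam i),
    perm_eq (lam i) [seq (pos x).1 : nat | x <- enum (B i)]
    & (\sum_(x in B i) (pos x).1 = (block_at i).1)%N].
Proof.
pose comp (y : 'I_W.+1 * 'I_W.+1) : nat := y.1.
have cnt i k :
    #|[set b in tabloid_of B | (cell_comp b.1 == k) && (b.2 == i)]%SET| =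
    count_mem k [seq (pos x).1 : nat | x <- enum (B i)].
  pose Ti := enum [set b in tabloid_of B | b.2 == i]%SET.
  transitivity (count_mem k [seq comp y | y <- [seq b.1.1 | b <- Ti]]).
    rewrite -map_comp count_map cardE -size_filter.
    apply: perm_size; apply: uniq_perm => [||b]; first exact: enum_uniq.
      by apply: filter_uniq; exact: enum_uniq.
    rewrite [LHS]mem_enum inE [RHS]mem_filter [in RHS]mem_enum !inE /=.
    by rewrite andbCA.
  transitivity (count_mem k [seq comp y | y <- [seq pos x | x <- enum (B i)]]).
    exact/permP/perm_map/tabloid_label_perm.
  by rewrite -map_comp.
have sumE i : sumn [seq (pos x).1 : nat | x <- enum (B i)] =
              (\sum_(x in B i) (pos x).1)%N.
  by rewrite sumnE big_map big_enum.
have no0 i : 0%N \notin [seq (pos x).1 : nat | x <- enum (B i)].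
  by apply/negP => /mapP[x _ x0]; move: (pos_gt0 x); rewrite -x0.
split=> [lamT i|H i].
  have [/and3P[srt lam0 /eqP <-] lamc] := lamT i.
  have pe : perm_eq (lam i) [seq (pos x).1 : nat | x <- enum (B i)].
    apply/allP => k _ /=; apply/eqP; case: (posnP k) => [->|k0].
      by rewrite (count_memPn lam0) (count_memPn (no0 i)).
    by rewrite -cnt lamc.
  by split=> //; rewrite -sumE; apply/esym/perm_sumn.
have [srt pe sm] := H i; split=> [|k k0]; last by rewrite cnt; apply/esym/permP.
by rewrite /is_partition srt (perm_mem pe) no0 (perm_sumn pe) sumE sm eqxx.
Qed.

Lemma has_contentP : (exists lam, has_content lam (tabloid_of B)) <->
  forall i, (\sum_(x in B i) (pos x).1 = (block_at i).1)%N.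
Proof.
split=> [[lam /content_perm H] i|H]; first by case: (H i).
exists [ffun i => sort geq [seq (pos x).1 : nat | x <- enum (B i)]].
apply/content_perm => i; rewrite ffunE; split=> //.
  by apply: sort_sorted => a b; exact: leq_total.
by rewrite perm_sort.
Qed.

Lemma size_content i : (exists lam, has_content lam (tabloid_of B)) ->
  size (content (tabloid_of B) i) = #|B i|.
Proof.
move=> /(xgetPex [ffun=> [::]])/content_perm/(_ i)[_ /perm_size + _].
by rewrite size_map -cardE.
Qed.

End Fill.

(** The number of parts of the partition chosen for the label [i] is [#|B i|],
    which matches the weights on both sides of the bijection. *)
Lemma sum_ETBT e :
  \sum_(T in ETBT tau sigma) \prod_i e ^+ size (content T i) =
  \sum_(B : {ffun 'I_(size sigma) -> {set I}} |
         is_incidence (fun x => (pos x).1) rowlen B) \prod_i e ^+ #|B i| :> rat.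
Proof.
rewrite (reindex_onto tabloid_of label_rows); last first.
  by move=> T; rewrite inE => /and3P[Tc Tl _]; exact: label_rowsK.
have condE B : (tabloid_of B \in ETBT tau sigma)
               && (label_rows (tabloid_of B) == B) =
    is_incidence (fun x => (pos x).1) rowlen B.
  rewrite inE; apply/andP/andP => [[/and3P[Tc Tl /asboolP Tx] /eqP rK]|[Bf Bd]].
    have Bf : fills rowlen B.
      by apply/forallP => x; rewrite -{1}rK rowlen_label_rows.
    by split=> //; apply/forallP => i; apply/eqP; move: i; apply/has_contentP.
  split; last by rewrite tabloid_ofK.
  rewrite tabloid_covering ?tabloid_labels//=; apply/asboolP.
  by apply/has_contentP => // i; apply/eqP; move: i; apply/forallP.
apply: eq_big => // B; rewrite condE => /andP[Bf /forallP Bd].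
apply: eq_bigr => i _; rewrite size_content//.
by apply/has_contentP => // j; apply/eqP.
Qed.

End Tabloids.

(** * The variables of a monomial as the rows of the diagram of its type *)

Section Slots.
Variable m : {cmonom var}.

(** Sorting the variables of degree [k] by decreasing exponent lists them in the
    order of the rows of the [k]-th component. *)
Definition slots (k : nat) : seq var :=
  sort (fun v w => (m w <= m v)%N) [seq v <- finsupp m | vdeg v == k].

Lemma slots_uniq k : uniq (slots k).
Proof. by rewrite sort_uniq filter_uniq// fset_uniq. Qed.

Lemma mem_slots k v : (v \in slots k) = (v \in finsupp m) && (vdeg v == k).
Proof. by rewrite mem_sort mem_filter andbC. Qed.

Lemma map_slots k : [seq m v | v <- slots k] = restr (mtype m) k.
Proof.
apply: (sorted_eq (leT := geq)).
- by move=> a b c; rewrite /geq /= => ba ac; exact: leq_trans ac ba.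
- by move=> a b; rewrite /geq /= andbC => /anti_leq.
- rewrite sorted_map; apply: sort_sorted => v w; exact: leq_total.
- exact/restr_sorted/mtype_is_type.
rewrite perm_sym (perm_trans (perm_map _ (perm_filter _ (perm_mtype m))))//.
by rewrite -/(restr _ k) restr_blocks perm_map// perm_sym perm_sort.
Qed.

Lemma row_length_slots k i v0 : (i < size (slots k))%N ->
  row_length (mtype m) k i = m (nth v0 (slots k) i).
Proof. by move=> ik; rewrite /row_length -map_slots (nth_map v0). Qed.

Let W := weight (mtype m).

Lemma exponent_bounds v : v \in finsupp m -> (vdeg v <= W)%N /\ (m v <= W)%N.
Proof.
move=> vm; have: (vdeg v, m v) \in mtype m.
  by rewrite (perm_mem (perm_mtype m)); apply: map_f.
move=> /(mem_type (mtype_is_type m))[/= d0 r0 drW].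
by split; apply: leq_trans drW; rewrite ?leq_pmulr ?leq_pmull.
Qed.

Lemma size_slots k : (size (slots k) <= W)%N.
Proof.
rewrite -(size_map m) map_slots /restr size_map size_filter.
rewrite (leq_trans (count_size _ _))// /W /weight -sum1_size.
rewrite big_seq [leqRHS]big_seq; apply: leq_sum => b.
by move=> /(mem_type (mtype_is_type m))[b1 b2 _]; rewrite muln_gt0 b1.
Qed.

Definition slot (x : finsupp m) : 'I_W.+1 * 'I_W.+1 :=
  (inord (vdeg (val x)), inord (index (val x) (slots (vdeg (val x))))).

Lemma index_slots (x : finsupp m) :
  (index (val x) (slots (vdeg (val x))) < size (slots (vdeg (val x))))%N.
Proof. by rewrite index_mem mem_slots eqxx andbT; exact: valP. Qed.

Lemma slot1 (x : finsupp m) : (slot x).1 = vdeg (val x) :> nat.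
Proof. by rewrite inordK// ltnS; case: (exponent_bounds (valP x)). Qed.

Lemma slot2 (x : finsupp m) :
  (slot x).2 = index (val x) (slots (vdeg (val x))) :> nat.
Proof.
rewrite inordK// ltnS (leq_trans _ (size_slots (vdeg (val x))))//.
by rewrite ltnW// index_slots.
Qed.

Lemma slot_inj : injective slot.
Proof.
move=> x y xy; apply: val_inj.
have dE : vdeg (val x) = vdeg (val y) by rewrite -!slot1 xy.
have iE := slot2 y; rewrite -xy slot2 dE in iE.
have xs : val x \in slots (vdeg (val y)).
  by rewrite mem_slots dE eqxx andbT; exact: valP.
have ys : val y \in slots (vdeg (val y)).
  by rewrite mem_slots eqxx andbT; exact: valP.
by rewrite -(nth_index (0, 0)%N xs) iE nth_index.
Qed.

Lemma slot_surj (k i : 'I_W.+1) : (0 < row_length (mtype m) k i)%N ->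
  exists x, slot x = (k, i).
Proof.
move=> ri; have ik : (i < size (slots k))%N.
  rewrite ltnNge; apply/negP => ki; move: ri.
  by rewrite /row_length nth_default// -map_slots size_map.
pose v := nth (0, 0)%N (slots k) i.
have: v \in slots k by apply: mem_nth.
rewrite mem_slots => /andP[vm /eqP vk].
exists (FSetSub vm); congr pair; apply: val_inj => /=.
  by rewrite inordK vk.
by rewrite vk /v index_uniq ?slots_uniq// inordK.
Qed.

(** A variable comes with the row whose length is its exponent because the
    rows of a component and its variables are both listed by decreasing
    size. *)
Lemma rowlen_slot x : rowlen slot x = m (val x).
Proof.
rewrite /rowlen slot1 slot2 (row_length_slots (0, 0)%N) ?index_slots//.
by rewrite nth_index// -index_mem index_slots.
Qed.

End Slots.

(** * The expansions of E^+ and E *)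

Lemma E_wt_finsupp (m : {cmonom var}) e sigma : is_type sigma ->
  E_wt e sigma m =
  \sum_(B : {ffun 'I_(size sigma) -> {set finsupp m}}
          | is_incidence (fun x => vdeg (val x)) (fun x => m (val x)) B)
    \prod_i e ^+ #|B i|.
Proof.
move=> /andP[sg _].
rewrite -E_wt_monom_of; first last.
- by apply: sub_all sg => b /andP[].
- exact: val_inj.
congr (E_wt _ _ _); apply: eq_monom_of => //; first exact: val_inj.
move=> w; apply: contraNeq; rewrite cmE_neq0 => wm.
by apply/codomP; exists (FSetSub wm).
Qed.

Lemma E_wt_ETBT e (m : {cmonom var}) sigma : is_type sigma ->
  E_wt e sigma m =
  \sum_(T in ETBT (mtype m) sigma) \prod_i e ^+ size (content T i).
Proof.
move=> sg; rewrite E_wt_finsupp// (sum_ETBT (pos := @slot m)).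
- apply: eq_bigl => B; rewrite /is_incidence /fills; congr andb;
    apply: eq_forallb => x.
    by rewrite rowlen_slot.
  by under [in RHS]eq_bigr do rewrite slot1.
- exact: slot_inj.
- by move=> x; rewrite slot1.
- by move=> k i _; exact: slot_surj.
- by move=> x; rewrite rowlen_slot; case: (exponent_bounds (valP x)).
by move=> l; case: (mem_type sg (mem_nth (0, 0)%N (ltn_ord l))).
Qed.

(** Both degrees are obtained by adding deg(x) r_i over the pairs (x, i) with
    x in B_i, once by rows and once by labels; so there is no incidence family
    when they differ. *)
Lemma E_wt_homogeneous e (m : {cmonom var}) sigma : is_type sigma ->
  mondeg m != weight sigma -> E_wt e sigma m = 0.
Proof.
move=> sg; rewrite E_wt_finsupp// => mN; apply: big_pred0 => B.
apply: contraNF mN => /andP[/forallP row /forallP deg].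
rewrite /mondeg big_seq_fsetE /weight (big_nth (0, 0)%N) big_mkord /=.
under eq_bigr => x _ do rewrite -(eqP (row x)) big_distrr big_mkcond /=.
rewrite exchange_big /=; apply/eqP/eq_bigr => i _.
by rewrite -big_mkcond -big_distrl /= (eqP (deg i)).
Qed.

Lemma E_wt_expansion n e sigma : type_of n sigma ->
  is_expansion n (E_wt e sigma)
    (fun tau => \sum_(T in ETBT tau sigma) \prod_i e ^+ size (content T i)).
Proof.
move=> /andP[sg /eqP sn]; apply/is_expansionP => m; case: ifPn => mn.
  exact: E_wt_ETBT.
by apply: E_wt_homogeneous; rewrite ?sn.
Qed.

Theorem corollary69 (n : nat) :
  (forall tau sigma : seq block, type_of n tau -> type_of n sigma ->
     transition n Eplus tau sigma = #|ETBT tau sigma|%:R)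
  /\
  (forall tau sigma : seq block, type_of n tau -> type_of n sigma ->
     transition n E tau sigma = \sum_(T in ETBT tau sigma) sgn T).
Proof.
have EplusE : Eplus = E_wt 1.
  apply/funext => sigma; apply: eq_bigr => b _; congr spow.
  by apply/funext => m; rewrite /E_wt_deg expr1n mul1r.
split=> tau sigma tau_n sigma_n; rewrite /transition.
  rewrite EplusE (mtensor_coefE (E_wt_expansion 1 sigma_n))//.
  rewrite -sumr_const; apply: eq_bigr => T _.
  by rewrite big1// => i _; rewrite expr1n.
(* [E] and [sgn] are by definition the instances of weight -1. *)
by rewrite (mtensor_coefE (E_wt_expansion (-1) sigma_n)).
Qed.
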